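(* Let $X$ be a $G$-space and let $f:X\rightarrow X$ be pseudoequivariant and totally $G$-transitive, and suppose that the set of $G_f$-periodic points of $f$ is dense in $X$. Then $f$ is weakly $G$-mixing.
   Context: A $G$-space $X$ is a topological space $X$ together with a topological group $G$ and a continuous action $G\times X\to X$, $(g,x)\mapsto g.x$. For $x\in X$, $G(x)=\{g.x:g\in G\}$; for $A\subseteq X$, $g.A=\{g.a:a\in A\}$. A map $f:X\to X$ is pseudoequivariant if it is continuous and $f(G(x))=G(f(x))$ for every $x\in X$. $\mathbb{N}$ is the set of positive integers and $f^k$ is the $k$-th iterate of $f$. A continuous map $f:X\to X$ is $G$-transitive if for any pair of nonempty open subsets $U,V$ of $X$ there exist $g\in G$ and $k\in\mathbb{N}$ with $g.f^k(U)\cap V\neq\emptyset$. It is totally $G$-transitive if $f^n$ is $G$-transitive for every $n\geqslant 1$. A point $x\in X$ is a $G_f$-periodic point of $f$ if there exist $g\in G$ and $k\in\mathbb{N}$ such that $g.f^k(x)=x$. The product $X\times X$ is a $G\times G$-space under $(g,h).(x,y)=(g.x,h.y)$. A continuous map $f:X\to X$ is weakly $G$-mixing if $f\times f$ is $G\times G$-transitive on $X\times X$; equivalently, for all nonempty open $U,V,E,F\subseteq X$ there exist $(g,h)\in G\times G$ and $k\in\mathbb{N}$ such that $g.f^k(U)\cap E\neq\emptyset$ and $h.f^k(V)\cap F\neq\emptyset$. *)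

(* Defs.v *)
From HB Require Import structures.
From mathcomp Require Import all_boot.
From mathcomp Require Import all_classical.
From mathcomp Require Import topology.

Set Implicit Arguments.
Unset Strict Implicit.
Unset Printing Implicit Defensive.

Local Open Scope classical_set_scope.

(* [groupType] is MathComp's class of arbitrary (possibly infinite) groups.
   No separation axiom is required of topological groups or of G-spaces. *)
HB.mixin Record Group_isTopologicalGroup G & Topological G & Group G := {
  mulg_continuous : continuous (fun p : G * G => (p.1 * p.2)%g) ;
  invg_continuous : continuous (fun g : G => g^-1%g)
}.

#[short(type="topologicalGroupType")]
HB.structure Definition TopologicalGroup :=
  {G of Topological G & Group G & Group_isTopologicalGroup G}.

HB.mixin Record Topological_isGSpace (G : topologicalGroupType) X
    & Topological X := {
  gact : G -> X -> X ;
  gact1 : forall x, gact 1%g x = x ;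
  gactM : forall g h x, gact (g * h)%g x = gact g (gact h x) ;
  gact_continuous : continuous (fun p : G * X => gact p.1 p.2)
}.

#[short(type="gspaceType")]
HB.structure Definition GSpace (G : topologicalGroupType) :=
  {X of Topological X & Topological_isGSpace G X}.

Section ContinuousPair.
Variables (S T U : topologicalType).

Lemma continuous_comp_fun (f : S -> T) (g : T -> U) :
  continuous f -> continuous g -> continuous (fun x => g (f x)).
Proof. by move=> cf cg x; apply: continuous_comp; [exact: cf|exact: cg]. Qed.

Lemma continuous_pair (f : S -> T) (g : S -> U) :
  continuous f -> continuous g -> continuous (fun x => (f x, g x)).
Proof. by move=> cf cg x; apply: cvg_pair; [exact: cf|exact: cg]. Qed.

End ContinuousPair.

Lemma fst_continuous (S T : topologicalType) : continuous (@fst S T).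
Proof. by move=> p; exact: cvg_fst. Qed.

Lemma snd_continuous (S T : topologicalType) : continuous (@snd S T).
Proof. by move=> p; exact: cvg_snd. Qed.

Lemma continuous_map2 (S1 T1 U1 S2 T2 U2 : topologicalType)
    (m1 : S1 * T1 -> U1) (m2 : S2 * T2 -> U2) :
  continuous m1 -> continuous m2 ->
  continuous (fun p : (S1 * S2) * (T1 * T2) =>
    (m1 (p.1.1, p.2.1), m2 (p.1.2, p.2.2))).
Proof.
move=> c1 c2; apply: continuous_pair.
- apply: (continuous_comp_fun _ c1); apply: continuous_pair.
  + by apply: continuous_comp_fun; exact: fst_continuous.
  + by apply: continuous_comp_fun; [exact: snd_continuous|exact: fst_continuous].
- apply: (continuous_comp_fun _ c2); apply: continuous_pair.
  + by apply: continuous_comp_fun; [exact: fst_continuous|exact: snd_continuous].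
  + by apply: continuous_comp_fun; exact: snd_continuous.
Qed.

Section ProductGroup.
Variables G H : topologicalGroupType.

Let prod_mulg_continuous :
  continuous (fun p : (G * H) * (G * H) => (p.1 * p.2)%g).
Proof.
exact: (continuous_map2 (@mulg_continuous G) (@mulg_continuous H)).
Qed.

Let prod_invg_continuous : continuous (fun g : G * H => g^-1%g).
Proof.
apply: (continuous_pair (f := fun g : G * H => g.1^-1%g)
  (g := fun g : G * H => g.2^-1%g)).
- by apply: continuous_comp_fun; [exact: fst_continuous|exact: invg_continuous].
- by apply: continuous_comp_fun; [exact: snd_continuous|exact: invg_continuous].
Qed.

HB.instance Definition _ := Group_isTopologicalGroup.Build (G * H)%type
  prod_mulg_continuous prod_invg_continuous.

End ProductGroup.

Section ProductGSpace.
Variables (G H : topologicalGroupType) (X : gspaceType G) (Y : gspaceType H).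

Let prod_gact (g : G * H) (p : X * Y) : X * Y := (gact g.1 p.1, gact g.2 p.2).

Let prod_gact1 p : prod_gact 1%g p = p.
Proof. by case: p => x y; rewrite /prod_gact !gact1. Qed.

Let prod_gactM g h p : prod_gact (g * h)%g p = prod_gact g (prod_gact h p).
Proof. by rewrite /prod_gact !gactM. Qed.

Let prod_gact_continuous :
  continuous (fun p : (G * H) * (X * Y) => prod_gact p.1 p.2).
Proof.
exact: (continuous_map2 (@gact_continuous G X) (@gact_continuous H Y)).
Qed.

HB.instance Definition _ := Topological_isGSpace.Build (G * H)%type (X * Y)%type
  prod_gact1 prod_gactM prod_gact_continuous.

End ProductGSpace.

Section Dynamics.
Variables (G : topologicalGroupType) (X : gspaceType G).
Implicit Types (f : X -> X) (x : X) (U V : set X).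

Definition gorbit x : set X := range (fun g : G => gact g x).

Definition pseudoequivariant f : Prop :=
  continuous f /\ forall x, f @` gorbit x = gorbit (f x).

Definition G_transitive f : Prop :=
  continuous f /\
  forall U V, open U -> open V -> U !=set0 -> V !=set0 ->
  exists (g : G) (k : nat),
    (0 < k)%N /\ ((gact g @` (iter k f @` U)) `&` V) !=set0.

Definition totally_G_transitive f : Prop :=
  forall n : nat, (1 <= n)%N -> G_transitive (iter n f).

Definition G_periodic f : set X :=
  [set x | exists (g : G) (k : nat), (0 < k)%N /\ gact g (iter k f x) = x].

End Dynamics.

Definition map_prod (X Y : Type) (f : X -> X) (h : Y -> Y) (p : X * Y) : X * Y :=
  (f p.1, h p.2).

Definition weakly_G_mixing (G : topologicalGroupType) (X : gspaceType G)
    (f : X -> X) : Prop :=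
  continuous f /\
  @G_transitive (G * G)%type (X * X)%type (map_prod f f).

(* Main.v *)
(** Given boxes [U x V] and [E x F], transitivity yields [g], [k] and a periodic
    point [p] in [U] with [g.f^k(p)] in [E].  If [m] is a period of [p], then the
    orbit of [f^(k+mj)(p)] meets [E] for every [j], so it remains to find [j]
    such that a translate of [f^(k+mj)(V)] meets [F]; this is transitivity of
    [f^m] from [V] to [f^-k(g'^-1.F)], for a [g'] making the latter nonempty. *)
Require Import Defs.
From HB Require Import structures.
From mathcomp Require Import all_boot.
From mathcomp Require Import all_classical.
From mathcomp Require Import topology.

Set Implicit Arguments.
Unset Strict Implicit.
Unset Printing Implicit Defensive.

Local Open Scope classical_set_scope.

Lemma continuous_iter (T : topologicalType) (f : T -> T) (n : nat) :
  continuous f -> continuous (iter n f).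
Proof.
move=> cf; elim: n => [|n IHn] x; first exact: cvg_id.
by rewrite /=; apply: continuous_comp; [exact: IHn|exact: cf].
Qed.

Lemma map_prod_continuous (S T : topologicalType) (f : S -> S) (h : T -> T) :
  continuous f -> continuous h -> continuous (map_prod f h).
Proof.
move=> cf ch; apply: continuous_pair.
- by apply: continuous_comp_fun => //; exact: fst_continuous.
- by apply: continuous_comp_fun => //; exact: snd_continuous.
Qed.

Lemma iter_map_prod (S T : Type) (f : S -> S) (h : T -> T) n p :
  iter n (map_prod f h) p = (iter n f p.1, iter n h p.2).
Proof. by elim: n => [|n /= ->] //; case: p. Qed.

Lemma open_prod_box (S T : topologicalType) (U : set (S * T)) :
  open U -> U !=set0 -> exists (A : set S) (B : set T),
    [/\ open A, open B, A !=set0, B !=set0 & A `*` B `<=` U].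
Proof.
move=> oU [[x y] Uxy].
have [[A B] [/= nA nB] sub] : nbhs (x, y) U by exact: open_nbhs_nbhs.
exists A°, B°; split; [exact: open_interior|exact: open_interior| | |].
- by exists x.
- by exists y.
- by move=> [a b] [/= /interior_subset Aa /interior_subset Bb]; apply: sub.
Qed.

Section GSpace.
Variables (G : topologicalGroupType) (X : gspaceType G).
Implicit Types (f : X -> X) (U V : set X).

Lemma gact_continuousr (g : G) : continuous (@gact G X g).
Proof.
apply: (@continuous_comp_fun X (G * X)%type X (fun x => (g, x))
  (fun p => gact p.1 p.2)); last exact: gact_continuous.
by apply: continuous_pair => x; [exact: cvg_cst|exact: cvg_id].
Qed.

Lemma open_gact_iter_preimage f (g : G) n V :
  continuous f -> open V -> open [set x | V (gact g (iter n f x))].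
Proof.
move=> cf oV.
apply: (@open_comp _ _ (fun x => gact g (iter n f x))) => // x _.
apply: (@continuous_comp_fun X X X (iter n f) (gact g)).
- exact: continuous_iter.
- exact: gact_continuousr.
Qed.

Lemma G_transitiveE f U V : G_transitive f ->
  open U -> open V -> U !=set0 -> V !=set0 ->
  exists (g : G) (k : nat) (x : X),
    [/\ (0 < k)%N, U x & V (gact g (iter k f x))].
Proof.
move=> [_ tf] oU oV U0 V0; have [g [k [k0 [y [[z [x Ux <-] <-] Vy]]]]] :=
  tf U V oU oV U0 V0.
by exists g, k, x.
Qed.

(** Each application of [f] sends a translate of a point into the orbit of its image, so a group
    element can be carried past [f] at the cost of replacing it. The new element may depend on the
    point. *)
Lemma pseudoequivariant_iter f n (g : G) x : pseudoequivariant f ->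
  exists h : G, iter n f (gact g x) = gact h (iter n f x).
Proof.
move=> [_ ef]; elim: n => [|n [h IHn]]; first by exists g.
have : (f @` gorbit (iter n f x)) (f (gact h (iter n f x))).
  by exists (gact h (iter n f x)) => //; exists h.
by rewrite ef => -[h' _ E]; exists h'; rewrite !iterS IHn E.
Qed.

(** Induction on [j]: if [h] brings [iter (m * j) f x] back to [x], carrying [h] past [m] further
    steps turns it into some [h'], and [g * h'] closes the longer loop. *)
Lemma periodic_multiple f (g : G) m x j : pseudoequivariant f ->
  gact g (iter m f x) = x -> exists h : G, gact h (iter (m * j) f x) = x.
Proof.
move=> pf px; elim: j => [|j [h IHj]]; first by exists 1%g; rewrite muln0 gact1.
have [h' E] := pseudoequivariant_iter m h (iter (m * j) f x) pf.
exists (g * h')%g; rewrite mulnS iterD gactM -E.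
by rewrite IHj.
Qed.

End GSpace.

Theorem proposition2p16 (G : topologicalGroupType) (X : gspaceType G)
    (f : X -> X) :
  pseudoequivariant f -> totally_G_transitive f -> dense (G_periodic f) ->
  weakly_G_mixing f.
Proof.
move=> pf tf dP; have cf := pf.1.
split; first exact: cf.
split; first exact: map_prod_continuous.
move=> UV EF oUV oEF UV0 EF0.
have [U [V [oU oV U0 V0 subUV]]] := open_prod_box oUV UV0.
have [E [F [oE oF E0 F0 subEF]]] := open_prod_box oEF EF0.
have [g [k [x [k0 Ux Ex]]]] := G_transitiveE (tf 1%N isT) oU oE U0 E0.
(* The point [x] shows that this open set is nonempty, so density lets a periodic point replace
   it. *)
have [p [[Up Ep] [a [m [m0 pp]]]]] :
    (U `&` [set y | E (gact g (iter k f y))]) `&` G_periodic f !=set0.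
  apply: dP; first by exists x.
  by apply: openI => //; exact: open_gact_iter_preimage.
(* A translate of [F] has to meet the image of [f^k]. Transitivity of [f] could return an exponent
   below [k]; that of [f^k] returns a positive multiple of [k]. *)
have [g' [i [y [i0 _ Fy]]]] : exists (g' : G) (i : nat) (y : X),
    [/\ (0 < i)%N, setT y & F (gact g' (iter i (iter k f) y))].
  apply: (G_transitiveE (tf k k0)) => //; first exact: openT.
  by exists p.
have [h [j [z [j0 Vz Fz]]]] : exists (h : G) (j : nat) (z : X),
    [/\ (0 < j)%N, V z &
      F (gact g' (iter k f (gact h (iter j (iter m f) z))))].
  apply: (G_transitiveE (V := [set y | F (gact g' (iter k f y))])
    (tf m m0)) => //; first exact: open_gact_iter_preimage.
  (* Since [i] is positive, one of the [i] applications of [f^k] can be split off; the other [i.-1]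
     give a point of the target set. *)
  by exists (iter i.-1 (iter k f) y); rewrite /= -iterS prednK.
(* Both translates, [b] of [f^(mj)(p)] and [h] of [f^(mj)(z)], sit inside [f^k]. Moving them outside
   gives [b'] and [h'], which combine with [g] and [g'] at the common exponent [k + m * j]. *)
have [b pb] := periodic_multiple j pf pp.
have [b' Eb] := pseudoequivariant_iter k b (iter (m * j) f p) pf.
have [h' Eh] := pseudoequivariant_iter k h (iter (m * j) f z) pf.
exists ((g * b')%g, (g' * h')%g), (k + m * j)%N; split.
  by rewrite addn_gt0 k0.
exists (gact (g * b')%g (iter (k + m * j) f p),
        gact (g' * h')%g (iter (k + m * j) f z)); split.
  exists (iter (k + m * j) (map_prod f f) (p, z)); last by rewrite iter_map_prod.
  by exists (p, z) => //; apply: subUV.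
apply: subEF; split => /=; rewrite gactM iterD.
- by rewrite -Eb pb.
- by rewrite -Eh mulnC iterM.
Qed.
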